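(* Let $p\ge2$, $m\ge1$, $d\ge1$, $S_1>0$. Consider sine networks $s^\theta(x)=V\sin(Wx)$ with $\theta=(W,V)\in\mathbb{R}^{d\times p}\times\mathbb{R}^{p\times d}$ and $\|V\|_\infty\le S_1$. For any $\gamma>0$ and $\delta\in(0,1)$, with probability at least $1-\delta$ over a training sample $S=\{(x^{(i)},y^{(i)})\}_{i=1}^n\sim\mathcal{D}_m^n$, simultaneously for all such $\theta$, \[ \mathbb{P}_{(X,Y)\sim\mathcal{D}_m}\big[h_\theta(X)\ne Y\big]\ \le\ \widehat{\mathcal{R}}_\gamma(s^\theta)+\widetilde{\mathcal{O}}\!\left(\frac{S_1}{\gamma}\cdot\frac{p}{\sqrt n}\right)+\widetilde{\mathcal{O}}\!\left(\frac1{\sqrt n}\right). \]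
   Context: Let $[p]=\{0,\dots,p-1\}$, $e_r$ the standard basis of $\mathbb{R}^p$, $\mathcal{X}_m=\{x\in\{0,\dots,m\}^p:\|x\|_1=m\}$. $\mathcal{D}_m$ is the law of $(X,Y)$ with $s_1,\dots,s_m$ i.i.d. uniform on $[p]$, $X=\sum_i e_{s_i}$, $Y=(\sum_i s_i)\bmod p$. The predictor is $h_\theta(x)=\ell$ if $s^\theta_\ell(x)>s^\theta_k(x)$ for all $k\ne\ell$, and $\bot$ (an error) otherwise. $\|V\|_\infty$ is the matrix $\infty$-norm, i.e. the maximum over rows of the row's $\ell_1$-norm. The empirical $\gamma$-margin error is $\widehat{\mathcal{R}}_\gamma(s^\theta)=\frac1n\sum_{i=1}^n\mathbf{1}\{s^\theta_{y^{(i)}}(x^{(i)})\le\gamma+\max_{j\ne y^{(i)}}s^\theta_j(x^{(i)})\}$. $\widetilde{\mathcal{O}}(\cdot)$ hides absolute constants and polylogarithmic factors (in $n,m,p,S_1,\delta^{-1}$). *)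

(* Defs.v *)
From HB Require Import structures.
From mathcomp Require Import all_boot all_order all_algebra.
From mathcomp Require Import boolp reals sequences trigo exp.
Set Implicit Arguments. Unset Strict Implicit. Unset Printing Implicit Defensive.
Import Order.TTheory GRing.Theory Num.Theory.
Local Open Scope ring_scope.

Definition draw (p m : nat) := {ffun 'I_m -> 'I_p}.

Definition sample (p m n : nat) := {ffun 'I_n -> draw p m}.

Section Defs.
Variable R : realType.

(* X = sum_i e_{s_i}, a column vector in R^p with entries the counts. *)
Definition Xof (p m : nat) (s : draw p m) : 'cV[R]_p :=
  \col_(r < p) (#|[set i | s i == r]|)%:R.

Definition Yof (p m : nat) (s : draw p m) : nat :=
  ((\sum_(i < m) (s i : nat)) %% p)%N.

Definition score (p d : nat) (W : 'M[R]_(d, p)) (V : 'M[R]_(p, d))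
  (x : 'cV[R]_p) : 'cV[R]_p := V *m map_mx sin (W *m x).

Definition predict (p d : nat) (W : 'M[R]_(d, p)) (V : 'M[R]_(p, d))
  (x : 'cV[R]_p) : option 'I_p :=
  [pick l : 'I_p | [forall k : 'I_p,
     (k != l) ==> (score W V x k 0 < score W V x l 0)]].

Definition misclassified (p m d : nat) (W : 'M[R]_(d, p)) (V : 'M[R]_(p, d))
  (s : draw p m) : bool :=
  match predict W V (Xof s) with
  | Some l => (l : nat) != Yof s
  | None => true
  end.

(* P_{(X,Y) ~ D_m}[h_theta(X) <> Y]; D_m is the push-forward of the uniform
   distribution on [p]^m. *)
Definition true_err (p m d : nat) (W : 'M[R]_(d, p)) (V : 'M[R]_(p, d)) : R :=
  (#|[set s : draw p m | misclassified W V s]|)%:R / (#|{: draw p m}|)%:R.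

(* Margin failure: s_y(x) <= gamma + max_{j <> y} s_j(x), written out as
   "exists j <> y with s_y(x) <= gamma + s_j(x)" (p >= 2 so the max is over a
   nonempty set). *)
Definition margin_fail (p m d : nat) (gamma : R) (W : 'M[R]_(d, p))
  (V : 'M[R]_(p, d)) (s : draw p m) : bool :=
  [exists k : 'I_p, ((k : nat) == Yof s) &&
     [exists j : 'I_p, (j != k) &&
        (score W V (Xof s) k 0 <= gamma + score W V (Xof s) j 0)]].

Definition emp_margin_err (p m n d : nat) (gamma : R) (W : 'M[R]_(d, p))
  (V : 'M[R]_(p, d)) (S : sample p m n) : R :=
  n%:R^-1 * \sum_(i < n) (margin_fail gamma W V (S i))%:R.

Definition normInf (p d : nat) (V : 'M[R]_(p, d)) : R :=
  \big[Num.max/0]_(i < p) \sum_(j < d) `|V i j|.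

Definition prob_sample (p m n : nat) (E : sample p m n -> Prop) : R :=
  (#|[set S : sample p m n | `[< E S >]]|)%:R / (#|{: sample p m n}|)%:R.

End Defs.

(* Main.v *)
Require Import Defs.
From HB Require Import structures.
From mathcomp Require Import all_boot all_order all_algebra.
From mathcomp Require Import boolp reals sequences trigo exp.
From mathcomp Require Import ring lra.
From mathcomp Require Import topology normedtype derive.
Set Implicit Arguments.
Unset Strict Implicit.
Unset Printing Implicit Defensive.
Import Order.TTheory GRing.Theory Num.Theory numFieldNormedType.Exports.
Local Open Scope ring_scope.

(** The margin argument of Schapire, Freund, Bartlett and Lee. The entries of X
    are integers, so sin (w . X) depends on w only modulo 2 pi, and rounding w to
    a grid of M = 64 m n points per coordinate moves it by O(m / M). Each row of
    V is S1 times a sub-probability on signed neurons; drawing N of them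
    independently for every class (Maurey sampling) and rounding their
    frequencies gives a network in a finite set of size M^(p^2 N), whose width
    does not enter. With N of order (S1 / gamma)^2 log (p n), the scores are
    within gamma / 4 except with probability O(1 / n), by Hoeffding, both under
    D_m and under the sample; hence one draw is good for both. A union bound over
    the finite set then controls the gamma / 2-margin errors of all these
    networks up to p (S1 / gamma) / sqrt n, up to logarithms. If gamma > 2 S1
    the empirical margin error is 1, and if the bound is at least 1 there is
    nothing to prove; this keeps log (S1 / gamma) out of the estimates. *)

(** * Exponential tail bounds *)

(** Multiply by [1 - x > 0]: the left side becomes at most 1, the right side [1 + x^2 (1 - 2x)],
    which is at least 1. *)
Lemma expR_le_quad (R : realType) (x : R) : x <= 1 / 2 -> expR x <= 1 + x + 2 * x ^+ 2.
Proof.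
move=> hx; have h0 : 0 < expR x by exact: expR_gt0.
have h1 : 1 - x <= expR (- x) by have := expR_ge1Dx (- x).
have h2 : expR x * (1 - x) <= 1.
  by rewrite -[leRHS](expRxMexpNx_1 x) ler_pM2l.
have h3 : 1 <= (1 + x + 2 * x ^+ 2) * (1 - x).
  have := mulr_ge0 (sqr_ge0 x) (_ : 0 <= 1 - 2 * x); nra.
by rewrite -(@ler_pM2r _ (1 - x)) ?(le_trans h2) //; lra.
Qed.

(** The linear term of the quadratic bound averages to zero, and [1 + y <= expR y] turns the
    remainder into an exponential. *)
Lemma mgf_bounded (R : realType) (T : finType) (q Z : T -> R) (b lam : R) :
  (forall t, 0 <= q t) -> \sum_t q t = 1 -> \sum_t q t * Z t = 0 ->
  (forall t, `|Z t| <= b) -> 0 <= lam -> lam * b <= 1 / 2 ->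
  \sum_t q t * expR (lam * Z t) <= expR (2 * (lam * b) ^+ 2).
Proof.
move=> q0 q1 qZ Zb l0 lb; apply: le_trans (expR_ge1Dx _).
have -> : 1 + 2 * (lam * b) ^+ 2 =
    \sum_t q t * (1 + lam * Z t + 2 * (lam * b) ^+ 2).
  transitivity (\sum_t (q t * (1 + 2 * (lam * b) ^+ 2) + lam * (q t * Z t))); last first.
    by apply: eq_bigr => t _; ring.
  by rewrite big_split /= -mulr_suml -mulr_sumr q1 qZ mulr0 mul1r addr0.
apply: ler_sum => t _; apply: ler_wpM2l => //.
have lZ : `|lam * Z t| <= lam * b by rewrite normrM ger0_norm // ler_wpM2l.
apply: le_trans (expR_le_quad _) _; first by rewrite (le_trans _ lb) // (le_trans (ler_norm _)).
rewrite lerD2l ler_pM2l // -(ger0_norm (sqr_ge0 (lam * Z t))) normrX.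
by rewrite lerXn2r ?nnegrE // (le_trans _ lZ).
Qed.

(** Chernoff's method: the indicator is at most [expR (lam * (sum - u))], whose mean factorises over
    the coordinates. Summing only over [P] lets one joint draw be tested class by class. *)
Lemma hoeffding_prod (R : realType) (I T : finType) (P : pred I)
    (q Z : I -> T -> R) (b lam u : R) :
  (forall i t, 0 <= q i t) -> (forall i, \sum_t q i t = 1) ->
  (forall i, P i -> \sum_t q i t * Z i t = 0) ->
  (forall i t, P i -> `|Z i t| <= b) -> 0 <= lam -> lam * b <= 1 / 2 ->
  \sum_(f : {ffun I -> T})
      (\prod_i q i (f i)) * (u <= \sum_(i | P i) Z i (f i))%R%:R
    <= expR (2 * (lam * b) ^+ 2 * #|P|%:R - lam * u).
Proof.
move=> q0 q1 qZ Zb l0 lb.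
pose E i t := if P i then expR (lam * Z i t) else 1.
have E0 i t : 0 <= E i t by rewrite /E; case: ifP => // _; exact: expR_ge0.
apply: (@le_trans _ _ (\sum_(f : {ffun I -> T})
   expR (- (lam * u)) * \prod_i (q i (f i) * E i (f i)))).
  apply: ler_sum => f _; rewrite big_split /= mulrCA; apply: ler_wpM2l.
    exact: prodr_ge0.
  rewrite /E -big_mkcond /= -expR_sum -expRD -mulr_sumr.
  case: (leP u) => h /=; last exact: expR_ge0.
  have : lam * u <= lam * \sum_(i | P i) Z i (f i) by rewrite ler_wpM2l.
  rewrite -[1]expR0 ler_expR; lra.
rewrite -mulr_sumr -(bigA_distr_bigA (fun i t => q i t * E i t)) /=.
rewrite addrC expRD; apply: ler_wpM2l; first exact: expR_ge0.
rewrite mulr_natr -sumr_const expR_sum (big_mkcond (fun i => i \in P)) /=.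
apply: ler_prod => i _; apply/andP; split.
  by apply: sumr_ge0 => t _; exact: mulr_ge0.
rewrite unfold_in /E; case: ifP => Pi; last first.
  by under eq_bigr => t _ do rewrite mulr1; rewrite q1.
by apply: mgf_bounded => // [|t]; [exact: qZ | exact: Zb].
Qed.

Lemma exists_le_mean (R : realType) (T : finType) (q F : T -> R) (c : R) :
  (forall t, 0 <= q t) -> \sum_t q t = 1 -> \sum_t q t * F t <= c ->
  exists t, F t <= c.
Proof.
move=> q0 q1 qF; apply: contrapT => /forallNP nF.
have Fc t : c < F t by rewrite ltNge; apply/negP/nF.
have : \sum_t q t * (F t - c) <= 0.
  under eq_bigr => t _ do rewrite mulrBr.
  by rewrite sumrB -mulr_suml q1 mul1r subr_le0.
have ge0 t : 0 <= q t * (F t - c) by rewrite mulr_ge0 // subr_ge0 ltW.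
move=> le0; have /eqP : \sum_t q t * (F t - c) = 0.
  by apply/eqP; rewrite eq_le le0 sumr_ge0.
rewrite psumr_eq0 // => /allP z; move: q1; rewrite big1 => [/eqP|t _].
  by rewrite eq_sym oner_eq0.
have := z t (mem_index_enum t); rewrite mulf_eq0 => /orP[/eqP //|].
by rewrite subr_eq0 => /eqP e; have := Fc t; rewrite e ltxx.
Qed.

Lemma prod_weight_sum1 (R : realType) (I T : finType) (q : I -> T -> R) :
  (forall i, \sum_t q i t = 1) ->
  \sum_(f : {ffun I -> T}) \prod_i q i (f i) = 1.
Proof. by move=> q1; rewrite -(bigA_distr_bigA q) /= big1. Qed.

(** * Rounding of frequencies *)

Lemma sin_lipschitz (R : realType) (x y : R) : `|sin x - sin y| <= `|x - y|.
Proof.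
wlog xy : x y / y < x => [hw|].
  have [/hw //|/hw h|->] := ltgtP y x; last by rewrite !subrr.
  by rewrite distrC (distrC x).
have [|c _ ->] := @MVT R sin cos y x xy (fun z _ => is_derive_sin z).
  by apply: continuous_subspaceT; exact: continuous_sin.
by rewrite normrM ler_piMl // cos_max.
Qed.

Lemma sin_periodz (R : realType) (x : R) (k : int) : sin (x + pi *+ 2 *~ k) = sin x.
Proof.
case: (intP k) => [|n|n]; first by rewrite mulr0z addr0.
  by rewrite -pmulrn (periodicn (@sinD2pi R)).
by rewrite mulrNz -pmulrn -{2}(subrK (pi *+ 2 *+ n.+1) x) (periodicn (@sinD2pi R)).
Qed.

Lemma pi_le4 (R : realType) : pi <= 4 :> R.
Proof. by have [/andP[_ h] _] := pihalf_02_cos_pihalf R; lra. Qed.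

Definition phase (R : realType) (p M : nat) (g : {ffun 'I_p -> 'I_M}) (x : 'cV[R]_p) : R :=
  \sum_r (pi *+ 2 / M%:R) * (g r)%:R * x r 0.

Lemma sum_Xof (R : realType) (p m : nat) (s : draw p m) : \sum_r Xof R s r 0 = m%:R.
Proof.
under eq_bigr => r _ do rewrite mxE.
rewrite -natr_sum; congr _%:R.
rewrite -[RHS](card_ord m) -sum1_card (partition_big s predT) //=.
by apply: eq_bigr => r _; rewrite -sum1dep_card.
Qed.

(* Since Xof R s has integer entries, the integer part t %/ M of the rounded
   frequency contributes a multiple of 2 pi. *)
Lemma sin_quantize (R : realType) (p m M : nat) (w : 'rV[R]_p) : (0 < M)%N ->
  exists g : {ffun 'I_p -> 'I_M}, forall s : draw p m,
    `|sin ((w *m Xof R s) 0 0) - sin (phase g (Xof R s))| <= 8 * m%:R / M%:R.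
Proof.
move=> M0; have M0R : 0 < M%:R :> R by rewrite ltr0n.
have pi0 : 0 < pi :> R by exact: pi_gt0.
set h : R := pi *+ 2 / M%:R.
have h0 : 0 < h by rewrite divr_gt0 // pmulrn_rgt0.
pose t r := Num.floor (w 0 r / h).
have tP r : 0 <= w 0 r - h * (t r)%:~R <= h.
  have /andP[] := floor_itv (w 0 r / h).
  rewrite ler_pdivlMr // ltr_pdivrMr // mulrC -/(t r) rmorphD /= => ? ?.
  by apply/andP; split; lra.
have Mz : M%:Z != 0 by rewrite eqz_nat -lt0n.
have tM r : (`|(t r %% M)%Z| < M)%N.
  by rewrite -ltz_nat gez0_abs ?modz_ge0 // ltz_pmod.
exists [ffun r => Ordinal (tM r)] => s.
pose K := \sum_r (t r %/ M)%Z * (#|[set i | s i == r]|%:Z).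
rewrite -(sin_periodz (phase _ _) K); apply: le_trans (sin_lipschitz _ _) _.
have -> : (w *m Xof R s) 0 0 - (phase [ffun r => Ordinal (tM r)] (Xof R s) + pi *+ 2 *~ K)
   = \sum_r (w 0 r - h * (t r)%:~R) * Xof R s r 0.
  rewrite !mxE /phase /K -mulrzr rmorph_sum /= mulr_sumr -big_split -sumrB /=.
  apply: eq_bigr => r _; rewrite ffunE /= mulrBl; congr (_ - _).
  have tE : (t r)%:~R = (t r %/ M)%Z%:~R * M%:R + (t r %% M)%Z%:~R :> R.
    by rewrite {1}(divz_eq (t r) M) rmorphD rmorphM.
  rewrite tE rmorphM /= -!pmulrn.
  have -> : (`|(t r %% M)%Z|%N)%:R = ((t r %% M)%Z)%:~R :> R.
    by rewrite pmulrn gez0_abs // modz_ge0.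
  rewrite mxE -/h (_ : pi *+ 2 = h * M%:R); last by rewrite /h divfK // gt_eqF.
  by ring.
rewrite (le_trans (ler_norm_sum _ _ _)) //.
apply: (@le_trans _ _ (\sum_r h * Xof R s r 0)).
  apply: ler_sum => r _; have /andP[? ?] := tP r.
  by rewrite ger0_norm ?mulr_ge0 ?ler_wpM2r ?mxE.
rewrite -mulr_sumr sum_Xof /h mulrAC ler_pM2r ?invr_gt0 // ler_wpM2r //.
(* The constant 8 comes from [2 pi <= 8]. *)
by have := pi_le4 R; rewrite -mulr_natr; lra.
Qed.

(** * Population and empirical averages *)

Definition avg (R : realType) (T : finType) (A : pred T) : R :=
  \sum_t #|T|%:R^-1 * (A t)%:R.

Definition emp (R : realType) (T : finType) (n : nat) (A : pred T) (S : {ffun 'I_n -> T}) : R :=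
  \sum_i n%:R^-1 * (A (S i))%:R.

Lemma avgE (R : realType) (T : finType) (A : pred T) :
  avg R A = #|[set t | A t]|%:R / #|T|%:R.
Proof.
rewrite /avg -mulr_sumr mulrC; congr (_ / _).
by rewrite -natr_sum -sum1dep_card [in RHS]big_mkcond.
Qed.

Lemma avg_ge0 (R : realType) (T : finType) (A : pred T) : 0 <= avg R A.
Proof. by apply: sumr_ge0 => t _; rewrite mulr_ge0 ?invr_ge0. Qed.

Lemma avg_le1 (R : realType) (T : finType) (A : pred T) : avg R A <= 1.
Proof.
rewrite avgE; have [->|T0] := posnP #|T|; first by rewrite invr0 mulr0.
by rewrite ler_pdivrMr ?ltr0n // mul1r ler_nat max_card.
Qed.

Lemma empirical_deviation (R : realType) (T : finType) (n : nat) (A : pred T) (e : R) :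
  (0 < #|T|)%N -> 0 <= e -> e <= 2 ->
  avg R (fun S : {ffun 'I_n -> T} => emp R A S + e <= avg R A)
    <= expR (- (n%:R * e ^+ 2 / 8)).
Proof.
move=> T0 e0 e2.
have T0R : 0 < #|T|%:R :> R by rewrite ltr0n.
case: n => [|n].
  rewrite mul0r mul0r oppr0 expR0; exact: avg_le1.
have n0 : 0 < n.+1%:R :> R by rewrite ltr0n.
have q1 : \sum_(t : T) #|T|%:R^-1 = 1 :> R.
  by rewrite sumr_const -[LHS]mulr_natl divff // gt_eqF.
(* [lam = e / 4] minimises [2 n lam^2 - lam n e], with value [- n e^2 / 8]; [e <= 2] ensures
   [lam <= 1 / 2]. *)
have := @hoeffding_prod R 'I_n.+1 T predT (fun _ _ => #|T|%:R^-1)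
  (fun _ t => avg R A - (A t)%:R) 1 (e / 4) (n.+1%:R * e).
have -> : 2 * (e / 4 * 1) ^+ 2 * #|(predT : pred 'I_n.+1)|%:R - e / 4 * (n.+1%:R * e) =
   - (n.+1%:R * e ^+ 2 / 8) by rewrite card_ord; field.
move=> h; apply: le_trans (h _ _ _ _ _ _) => {h} //.
- apply: ler_sum => S _; rewrite prodr_const card_ffun !card_ord natrX exprVn.
  apply: ler_wpM2l; first by rewrite invr_ge0 exprn_ge0.
  rewrite sumrB sumr_const card_ord.
  case: (leP (emp R A S + e)) => //= hS; case: (leP (n.+1%:R * e)) => //=.
  have := ler_wpM2l (ltW n0) hS; rewrite /emp -mulr_sumr mulrDr mulVKf ?gt_eqF //.
  by rewrite -[avg R A *+ _]mulr_natl; clear; lra.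
- by move=> _ t; rewrite invr_ge0.
- move=> _ _; under eq_bigr => t _ do rewrite mulrBr.
  by rewrite sumrB -mulr_suml q1 mul1r subrr.
- move=> _ t _; have := avg_ge0 R A; have := avg_le1 R A.
  by case: (A t) => /= ? ?; rewrite ler_norml; apply/andP; split; lra.
- lra.
- lra.
Qed.

Lemma avg_exists_le (R : realType) (T G : finType) (A : G -> pred T) (c : R) :
  (forall g, avg R (A g) <= c) ->
  avg R (fun t => [exists g, A g t]) <= #|G|%:R * c.
Proof.
move=> Ac; rewrite mulr_natl -sumr_const.
apply: (@le_trans _ _ (\sum_g avg R (A g))); last exact: ler_sum.
rewrite exchange_big /=; apply: ler_sum => t _.
rewrite -mulr_sumr ler_wpM2l ?invr_ge0 //.
case: existsP => [[g Ag]|_]; last exact: sumr_ge0.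
by rewrite (bigD1 g) //= Ag lerDl sumr_ge0.
Qed.

(** * Maurey sampling *)

(** Oddness of sine moves the sign of an output weight into the frequency, which leaves nonnegative
    weights to sample from. *)
Lemma norm_sin_sg (R : realType) (v t : R) : `|v| * sin (Num.sg v * t) = v * sin t.
Proof.
have [v0|v0|->] := ltgtP v 0; last by rewrite normr0 !mul0r.
  by rewrite ltr0_norm // ltr0_sg // mulN1r sinN mulrNN.
by rewrite gtr0_norm // gtr0_sg // mul1r.
Qed.

Lemma normInf_row (R : realType) (p d : nat) (V : 'M[R]_(p, d)) k :
  \sum_i `|V k i| <= normInf V.
Proof. exact: (le_bigmax 0 (fun k => \sum_i `|V k i|)). Qed.

Lemma scoreE (R : realType) (p d : nat) (W : 'M[R]_(d, p)) (V : 'M[R]_(p, d)) x k :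
  score W V x k 0 = \sum_i V k i * sin ((W *m x) i 0).
Proof. by rewrite mxE; apply: eq_bigr => i _; rewrite mxE. Qed.

Lemma score_le (R : realType) (p d : nat) (W : 'M[R]_(d, p)) (V : 'M[R]_(p, d)) x k :
  `|score W V x k 0| <= normInf V.
Proof.
apply: le_trans (normInf_row V k); rewrite scoreE (le_trans (ler_norm_sum _ _ _)) //.
by apply: ler_sum => i _; rewrite normrM ler_piMr // sin_max.
Qed.

(* Row k of V is a sub-probability on signed neurons once divided by S1; the
   missing mass is put on the zero frequency [inl tt]. *)
Definition neuron (R : realType) (p d : nat) (W : 'M[R]_(d, p)) (V : 'M[R]_(p, d))
    (k : 'I_p) (o : unit + 'I_d) : 'rV[R]_p :=
  match o with inl _ => 0 | inr i => Num.sg (V k i) *: row i W end.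

Definition neuron_weight (R : realType) (p d : nat) (V : 'M[R]_(p, d)) (S1 : R)
    (k : 'I_p) (o : unit + 'I_d) : R :=
  match o with inl _ => 1 - \sum_i `|V k i| / S1 | inr i => `|V k i| / S1 end.

Lemma neuron_weight_ge0 (R : realType) (p d : nat) (V : 'M[R]_(p, d)) (S1 : R) k o :
  0 < S1 -> normInf V <= S1 -> 0 <= neuron_weight V S1 k o.
Proof.
move=> S0 VS; case: o => [_|i] /=; last by rewrite divr_ge0 // ltW.
rewrite -mulr_suml subr_ge0 ler_pdivrMr // mul1r.
exact: le_trans (normInf_row V k) VS.
Qed.

Lemma neuron_weight_sum (R : realType) (p d : nat) (V : 'M[R]_(p, d)) (S1 : R) k :
  \sum_o neuron_weight V S1 k o = 1.
Proof. by rewrite big_sumType /= (big_pred1 tt) ?subrK // => -[]. Qed.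

Lemma neuron_mean (R : realType) (p d : nat) (W : 'M[R]_(d, p)) (V : 'M[R]_(p, d)) (S1 : R) k x :
  \sum_o neuron_weight V S1 k o * sin ((neuron W V k o *m x) 0 0)
    = score W V x k 0 / S1.
Proof.
rewrite big_sumType /= (big_pred1 tt) => [|[] //].
rewrite mul0mx mxE sin0 mulr0 add0r scoreE mulr_suml; apply: eq_bigr => i _.
by rewrite -scalemxAl mxE -row_mul mxE mulrAC norm_sin_sg.
Qed.

(** [N] frequency vectors per class with all coordinates on the grid: [M^(p^2 N)] elements, whatever
    the width [d]. *)
Definition grid_net (p M N : nat) := {ffun 'I_p * 'I_N -> {ffun 'I_p -> 'I_M}}.

Definition gscore (R : realType) (p M N : nat) (S1 : R) (g : grid_net p M N) (x : 'cV[R]_p) k : R :=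
  S1 / N%:R * \sum_(a | a.1 == k) sin (phase (g a) x).

Lemma card_fst (p N : nat) (k : 'I_p) : #|[pred a : 'I_p * 'I_N | a.1 == k]| = N.
Proof.
rewrite -[RHS]card_ord -sum1_card (reindex (fun t : 'I_N => (k, t))) /=.
  by rewrite -sum1_card; apply: eq_bigl => t; rewrite !inE eqxx.
by exists snd => [//|[a t] /eqP /= ->].
Qed.

Definition far (R : realType) (p M N m d : nat) (S1 gamma : R) (g : grid_net p M N)
    (W : 'M[R]_(d, p)) (V : 'M[R]_(p, d)) (s : draw p m) : bool :=
  [exists k, gamma / 4 < `|gscore S1 g (Xof R s) k - score W V (Xof R s) k 0|].

(** The expected [P]-mass of the far points over a random draw obeys the bound, so some draw does.
    Rounding and sampling each use half of the allowance [gamma / 4]. An arbitrary [P] lets one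
    network serve two distributions at once. *)
Lemma maurey_sampling (R : realType) (p M N m d : nat) (S1 gamma : R)
    (W : 'M[R]_(d, p)) (V : 'M[R]_(p, d)) (P : draw p m -> R) :
  (0 < M)%N -> (0 < N)%N -> 0 < S1 -> 0 < gamma -> gamma <= 2 * S1 ->
  normInf V <= S1 -> S1 * (8 * m%:R / M%:R) <= gamma / 8 ->
  (forall s, 0 <= P s) ->
  exists g : grid_net p M N, \sum_s P s * (far S1 gamma g W V s)%:R
    <= (\sum_s P s) * (2 * p%:R * expR (- (N%:R * (gamma / (8 * S1)) ^+ 2 / 32))).
Proof.
move=> M0 N0 S0 g0 gS VS hM P0.
have N0R : 0 < N%:R :> R by rewrite ltr0n.
have [Q QP] := choice (fun w => @sin_quantize R p m M w M0).
pose G (f : {ffun 'I_p * 'I_N -> unit + 'I_d}) : grid_net p M N :=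
  [ffun a => Q (neuron W V a.1 (f a))].
pose q (a : 'I_p * 'I_N) o := neuron_weight V S1 a.1 o.
have q0 a o : 0 <= q a o by exact: neuron_weight_ge0.
have q1 a : \sum_o q a o = 1 by exact: neuron_weight_sum.
(* The sampling allowance [gamma / 8] in units of [S1]; the sum over the [N] neurons of a class is
   compared with [N * tau]. *)
set tau := gamma / (8 * S1).
have tau0 : 0 < tau by rewrite divr_gt0 // mulr_gt0.
have tau1 : tau <= 1 / 4 by rewrite /tau ler_pdivrMr ?mulr_gt0 //; lra.
set B := expR _.
pose Z (s : draw p m) (a : 'I_p * 'I_N) o :=
  sin ((neuron W V a.1 o *m Xof R s) 0 0) - score W V (Xof R s) a.1 0 / S1.
have Zb s a o : `|Z s a o| <= 2.
  have h1 := sin_max ((neuron W V a.1 o *m Xof R s) 0 0).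
  have h2 : `|score W V (Xof R s) a.1 0 / S1| <= 1.
    rewrite normrM normfV (gtr0_norm S0) ler_pdivrMr // mul1r.
    exact: le_trans (score_le _ _ _ _) VS.
  by rewrite (le_trans (ler_normB _ _)) //; lra.
have Zm s a : \sum_o q a o * Z s a o = 0.
  under eq_bigr => o _ do rewrite mulrBr.
  by rewrite sumrB neuron_mean -mulr_suml q1 mul1r subrr.
have tail (Y : 'I_p * 'I_N -> unit + 'I_d -> R) k :
    (forall a o, `|Y a o| <= 2) -> (forall a, \sum_o q a o * Y a o = 0) ->
    \sum_(f : {ffun 'I_p * 'I_N -> unit + 'I_d}) (\prod_a q a (f a)) *
       (N%:R * tau <= \sum_(a | a.1 == k) Y a (f a))%R%:R <= B.
  move=> Yb Ym.
  (* [lam = tau / 16] minimises [8 N lam^2 - lam N tau], with value [- N tau^2 / 32]. *)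
  have := @hoeffding_prod R _ _ (fun a => a.1 == k) q Y 2 (tau / 16) (N%:R * tau) q0 q1.
  rewrite card_fst => h; apply: le_trans (h _ _ _ _) _ => {h} //; try lra.
  by rewrite /B ler_expR le_eqVlt; apply/orP; left; apply/eqP; field.
have farP f s : (far S1 gamma (G f) W V s)%:R <= \sum_k
    ((N%:R * tau <= \sum_(a | a.1 == k) Z s a (f a))%R%:R +
     (N%:R * tau <= \sum_(a | a.1 == k) - Z s a (f a))%R%:R) :> R.
  rewrite /far; case: existsP => [[k hk]|_]; last by apply: sumr_ge0 => k _; rewrite addr_ge0.
  rewrite (bigD1 k) //= -[leLHS]addr0 lerD //; last by apply: sumr_ge0 => j _; rewrite addr_ge0.
  suff h : N%:R * tau <= `|\sum_(a | a.1 == k) Z s a (f a)|.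
    rewrite sumrN; move: h; rewrite ler_normr => /orP[] ->.
      by rewrite lerDl.
    by rewrite lerDr.
  (* [r] is the score of the sampled network before its frequencies are rounded. *)
  pose r := S1 / N%:R * \sum_(a | a.1 == k) sin ((neuron W V a.1 (f a) *m Xof R s) 0 0).
  have hr : `|gscore S1 (G f) (Xof R s) k - r| <= gamma / 8.
    rewrite /gscore /r -mulrBr -sumrB normrM gtr0_norm ?divr_gt0 //.
    apply: (@le_trans _ _ (S1 / N%:R * (N%:R * (8 * m%:R / M%:R)))).
      apply: ler_wpM2l; first by rewrite ltW // divr_gt0.
      apply: le_trans (ler_norm_sum _ _ _) _.
      rewrite mulr_natl -[in leRHS](@card_fst p N k) -sumr_const.
      by apply: ler_sum => a _; rewrite ffunE distrC QP.
    by rewrite (_ : _ * _ = S1 * (8 * m%:R / M%:R)) //; field; rewrite !gt_eqF // ltr0n.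
  have hZ : r - score W V (Xof R s) k 0 = S1 / N%:R * \sum_(a | a.1 == k) Z s a (f a).
    have -> : \sum_(a | a.1 == k) Z s a (f a) =
        \sum_(a | a.1 == k) sin ((neuron W V a.1 (f a) *m Xof R s) 0 0)
        - N%:R * (score W V (Xof R s) k 0 / S1).
      rewrite /Z sumrB; congr (_ - _).
      transitivity (\sum_(a : 'I_p * 'I_N | a.1 == k) (score W V (Xof R s) k 0 / S1)).
        by apply: eq_bigr => a /eqP ->.
      by rewrite sumr_const card_fst -[LHS]mulr_natl.
    by rewrite mulrBr -/r; congr (_ - _); field; rewrite !gt_eqF.
  have h3 : gamma / 8 <= S1 / N%:R * `|\sum_(a | a.1 == k) Z s a (f a)|.
    rewrite -[S1 / N%:R]gtr0_norm ?divr_gt0 // -normrM -hZ.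
    have := ler_distD r (gscore S1 (G f) (Xof R s) k) (score W V (Xof R s) k 0); lra.
  have := ler_wpM2l (ltW (divr_gt0 N0R S0)) h3.
  have -> : N%:R / S1 * (gamma / 8) = N%:R * tau by rewrite /tau; field; rewrite gt_eqF.
  have cancelK (y : R) : N%:R / S1 * (S1 / N%:R * y) = y by field; rewrite !gt_eqF.
  by rewrite cancelK.
suff [f hf] : exists f, \sum_s P s * (far S1 gamma (G f) W V s)%:R
    <= (\sum_s P s) * (2 * p%:R * B) by exists (G f).
apply: (@exists_le_mean _ _ (fun f : {ffun 'I_p * 'I_N -> unit + 'I_d} => \prod_a q a (f a))).
- by move=> f; exact: prodr_ge0.
- exact: prod_weight_sum1.
under eq_bigr => f _ do rewrite mulr_sumr.
(* With the sums exchanged, it suffices that each fixed point is far with probability at most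
   [2 p B]: a union over classes and two signs. *)
rewrite exchange_big /= mulr_suml; apply: ler_sum => s _.
under eq_bigr => f _ do rewrite mulrCA.
rewrite -mulr_sumr ler_wpM2l //.
apply: (@le_trans _ _ (\sum_(f : {ffun 'I_p * 'I_N -> unit + 'I_d}) (\prod_a q a (f a)) * \sum_k
    ((N%:R * tau <= \sum_(a | a.1 == k) Z s a (f a))%R%:R +
     (N%:R * tau <= \sum_(a | a.1 == k) - Z s a (f a))%R%:R))).
  by apply: ler_sum => f _; rewrite ler_wpM2l ?farP // prodr_ge0.
under eq_bigr => f _ do rewrite mulr_sumr.
rewrite exchange_big /=; apply: (@le_trans _ _ (\sum_(k < p) 2 * B)); last first.
  by rewrite sumr_const card_ord -[leLHS]mulr_natl mulrCA mulrA.
apply: ler_sum => k _; under eq_bigr => f _ do rewrite mulrDr.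
rewrite big_split /= [2 * B]mulr_natl mulr2n; apply: lerD; first exact: (tail (Z s)).
apply: (tail (fun a o => - Z s a o)) => [a o|a]; first by rewrite normrN.
by under eq_bigr => o _ do rewrite mulrN; rewrite sumrN Zm oppr0.
Qed.

(** * Margin bound *)

(** The threshold [gamma / 2] lies midway between 0 and [gamma]: errors of [gamma / 4] in each of
    two scores cannot cross either gap. *)
Definition gfail (R : realType) (p M N m : nat) (S1 gamma : R) (g : grid_net p M N)
    (s : draw p m) : bool :=
  [exists k : 'I_p, ((k : nat) == Yof s) &&
     [exists j : 'I_p, (j != k) &&
        (gscore S1 g (Xof R s) k <= gamma / 2 + gscore S1 g (Xof R s) j)]].

Lemma near_gscore (R : realType) (p M N m d : nat) (S1 gamma : R) (g : grid_net p M N)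
    (W : 'M[R]_(d, p)) (V : 'M[R]_(p, d)) (s : draw p m) k :
  ~~ far S1 gamma g W V s ->
  `|gscore S1 g (Xof R s) k - score W V (Xof R s) k 0| <= gamma / 4.
Proof. by move=> /existsPn /(_ k); rewrite -leNgt. Qed.

Lemma misclassified_gfail (R : realType) (p M N m d : nat) (S1 gamma : R)
    (g : grid_net p M N) (W : 'M[R]_(d, p)) (V : 'M[R]_(p, d)) (s : draw p m) :
  (0 < p)%N -> ~~ far S1 gamma g W V s -> misclassified W V s -> gfail S1 gamma g s.
Proof.
move=> p0 nf; apply: contraTT => ng.
pose k := Ordinal (ltn_pmod (\sum_(i < m) (s i : nat)) p0).
have best j : j != k -> score W V (Xof R s) j 0 < score W V (Xof R s) k 0.
  move=> jk; move/existsPn: ng => /(_ k); rewrite eqxx /= => /existsPn /(_ j).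
  rewrite jk /= -ltNge => h; have := near_gscore j nf; have := near_gscore k nf.
  by rewrite !ler_norml => /andP[? ?] /andP[? ?]; lra.
rewrite /misclassified /predict; case: pickP => [l|none].
  move=> /forallP /(_ k); have [<- //|lk /=] := eqVneq k l; first by rewrite eqxx.
  by move=> h; have := lt_trans h (best l _); rewrite ltxx eq_sym => /(_ lk).
by have := none k; move/negbT/negP; case; apply/forallP => j; apply/implyP/best.
Qed.

Lemma gfail_margin_fail (R : realType) (p M N m d : nat) (S1 gamma : R)
    (g : grid_net p M N) (W : 'M[R]_(d, p)) (V : 'M[R]_(p, d)) (s : draw p m) :
  ~~ far S1 gamma g W V s -> gfail S1 gamma g s -> margin_fail gamma W V s.
Proof.
move=> nf /existsP[k /andP[kY /existsP[j /andP[jk h]]]].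
apply/existsP; exists k; rewrite kY; apply/existsP; exists j; rewrite jk /=.
have := near_gscore j nf; have := near_gscore k nf.
by rewrite !ler_norml => /andP[? ?] /andP[? ?]; lra.
Qed.

Lemma avg_le_or (R : realType) (T : finType) (A B C : pred T) :
  (forall t, ~~ C t -> A t -> B t) -> avg R A <= avg R B + avg R C.
Proof.
move=> h; rewrite /avg -big_split; apply: ler_sum => t _ /=.
rewrite -mulrDr ler_wpM2l ?invr_ge0 // -natrD ler_nat.
by have := h t; case: (A t) (B t) (C t) => [] [] [] // /(_ isT isT).
Qed.

Lemma emp_le_or (R : realType) (T : finType) (n : nat) (A B C : pred T) (S : {ffun 'I_n -> T}) :
  (forall t, ~~ C t -> A t -> B t) -> emp R A S <= emp R B S + emp R C S.
Proof.
move=> h; rewrite /emp -big_split; apply: ler_sum => i _ /=.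
rewrite -mulrDr ler_wpM2l ?invr_ge0 // -natrD ler_nat.
by have := h (S i); case: (A _) (B _) (C _) => [] [] [] // /(_ isT isT).
Qed.

(** Puts the empirical average in the weighted form that [maurey_sampling] accepts. *)
Lemma empE (R : realType) (T : finType) (n : nat) (A : pred T) (S : {ffun 'I_n -> T}) :
  emp R A S = \sum_t (\sum_i n%:R^-1 * (S i == t)%:R) * (A t)%:R.
Proof.
under eq_bigr => t _ do rewrite mulr_suml.
rewrite exchange_big; apply: eq_bigr => i _ /=.
rewrite (bigD1 (S i)) //= eqxx mulr1 big1 ?addr0 // => t tS.
by rewrite eq_sym (negbTE tS) mulr0 mul0r.
Qed.

(** Pass from the true error to the population [gfail], then to the empirical [gfail] at cost [e],
    then to the empirical margin error; the outer two passages cost the two masses of far points. *)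
Lemma margin_transfer (R : realType) (p M N m n d : nat) (S1 gamma e : R)
    (W : 'M[R]_(d, p)) (V : 'M[R]_(p, d)) (S : sample p m n) :
  (0 < p)%N -> (0 < M)%N -> (0 < N)%N -> 0 < S1 -> 0 < gamma -> gamma <= 2 * S1 ->
  normInf V <= S1 -> S1 * (8 * m%:R / M%:R) <= gamma / 8 ->
  (forall g : grid_net p M N,
    avg R (gfail (m := m) S1 gamma g) <= emp R (gfail S1 gamma g) S + e) ->
  true_err m W V <= emp_margin_err gamma W V S + e
    + 4 * p%:R * expR (- (N%:R * (gamma / (8 * S1)) ^+ 2 / 32)).
Proof.
move=> p0 M0 N0 S0 g0 gS VS hM unif.
(* Population plus empirical mass, of total at most 2. The resulting [g] depends on the sample,
   which is harmless since [unif] holds for all [g]. *)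
pose P (s : draw p m) := #|{: draw p m}|%:R^-1 + \sum_i n%:R^-1 * (S i == s)%:R : R.
have P0 s : 0 <= P s.
  by rewrite addr_ge0 ?invr_ge0 // sumr_ge0 // => i _; rewrite mulr_ge0 ?invr_ge0.
have PE (A : pred (draw p m)) : \sum_s P s * (A s)%:R = avg R A + emp R A S.
  by rewrite empE -big_split; apply: eq_bigr => s _ /=; rewrite mulrDl.
have P2 : \sum_s P s <= 2.
  have -> : \sum_s P s = avg R (fun _ : draw p m => true) + emp R (fun=> true) S.
    by rewrite -PE; apply: eq_bigr => s _; rewrite mulr1.
  rewrite (_ : 2 = 1 + 1 :> R) // lerD ?avg_le1 // /emp -mulr_sumr sumr_const card_ord.
  (* For [n = 0] the empirical mass is 0, otherwise 1. *)
  by case: (n) => [|k]; rewrite ?invr0 ?mul0r // mulVf // pnatr_eq0.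
have [g] := maurey_sampling W M0 N0 S0 g0 gS VS hM P0.
rewrite PE => hg.
have B0 : 0 <= 2 * p%:R * expR (- (N%:R * (gamma / (8 * S1)) ^+ 2 / 32)) :> R.
  by rewrite mulr_ge0 ?mulr_ge0 ?expR_ge0.
have {}hg := le_trans hg (ler_wpM2r B0 P2).
have h1 : true_err m W V <= avg R (gfail (m := m) S1 gamma g) + avg R (far (m := m) S1 gamma g W V).
  rewrite (_ : true_err m W V = avg R (fun s : draw p m => misclassified W V s));
    last by rewrite avgE.
  by apply: avg_le_or => s nf; exact: (misclassified_gfail p0 nf).
have h2 : emp R (gfail S1 gamma g) S <= emp_margin_err gamma W V S + emp R (far S1 gamma g W V) S.
  rewrite (_ : emp_margin_err _ _ _ _ = emp R (fun s => margin_fail gamma W V s) S).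
    by apply: emp_le_or => s nf; exact: (gfail_margin_fail nf).
  by rewrite /emp -mulr_sumr.
have := unif g; lra.
Qed.

(** * Trivial bounds on the two errors *)

Lemma true_err_le1 (R : realType) (p m d : nat) (W : 'M[R]_(d, p)) (V : 'M[R]_(p, d)) :
  true_err m W V <= 1.
Proof.
by rewrite (_ : true_err m W V = avg R (fun s : draw p m => misclassified W V s)) ?avg_le1 // avgE.
Qed.

Lemma emp_margin_err_ge0 (R : realType) (p m n d : nat) (gamma : R)
    (W : 'M[R]_(d, p)) (V : 'M[R]_(p, d)) (S : sample p m n) :
  0 <= emp_margin_err gamma W V S.
Proof. by rewrite mulr_ge0 ?invr_ge0 // sumr_ge0. Qed.

(** Two scores differ by at most [2 * normInf V], so the true class never exceeds another class by
    more than [gamma]. *)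
Lemma large_margin_err (R : realType) (p m n d : nat) (gamma : R)
    (W : 'M[R]_(d, p)) (V : 'M[R]_(p, d)) (S : sample p m n) :
  (1 < p)%N -> (0 < n)%N -> 2 * normInf V <= gamma -> emp_margin_err gamma W V S = 1.
Proof.
move=> p1 n0 hV; have p0 : (0 < p)%N by exact: ltnW.
have fail s : margin_fail gamma W V (s : draw p m).
  pose k := Ordinal (ltn_pmod (\sum_(i < m) (s i : nat)) p0).
  have [j jk] : exists j : 'I_p, j != k.
    have [k0|k0] := eqVneq (k : nat) 0%N.
      by exists (Ordinal p1); apply/eqP => e; move: k0; rewrite -e.
    by exists (Ordinal p0); apply/eqP => e; move: k0; rewrite -e.
  apply/existsP; exists k; rewrite eqxx; apply/existsP; exists j; rewrite jk /=.
  have := score_le W V (Xof R s) k; have := score_le W V (Xof R s) j.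
  by rewrite !ler_norml => /andP[? ?] /andP[? ?]; lra.
rewrite /emp_margin_err; under eq_bigr => i _ do rewrite fail.
by rewrite sumr_const card_ord mulVf // pnatr_eq0 -lt0n.
Qed.

(** * Uniform deviation over the grid networks *)

Lemma avg_ge_compl (R : realType) (T : finType) (A B : pred T) :
  (0 < #|T|)%N -> (forall t, ~~ B t -> A t) -> 1 - avg R B <= avg R A.
Proof.
move=> T0 h; rewrite lerBlDr.
have -> : 1 = avg R (fun _ : T => true).
  by rewrite avgE cardsT divff // pnatr_eq0 -lt0n.
by apply: avg_le_or => t /h.
Qed.

Lemma card_draw_gt0 (p m : nat) : (0 < p)%N -> (0 < #|{: draw p m}|)%N.
Proof. by move=> p0; rewrite card_ffun !card_ord expn_gt0 p0. Qed.

Lemma uniform_deviation (R : realType) (p M N m n : nat) (S1 gamma e delta : R) :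
  (0 < p)%N -> 0 <= e -> e <= 2 ->
  #|{: grid_net p M N}|%:R * expR (- (n%:R * e ^+ 2 / 8)) <= delta ->
  1 - delta <= avg R (fun S : sample p m n => [forall g : grid_net p M N,
    avg R (gfail (m := m) S1 gamma g) <= emp R (gfail S1 gamma g) S + e]).
Proof.
move=> p0 e0 e2 hdelta; have T0 := card_draw_gt0 m p0.
pose bad (g : grid_net p M N) (S : sample p m n) :=
  emp R (gfail S1 gamma g) S + e <= avg R (gfail (m := m) S1 gamma g).
apply: (@le_trans _ _ (1 - avg R (fun S => [exists g, bad g S]))); last first.
  apply: avg_ge_compl => [|S]; first by rewrite card_ffun expn_gt0 T0.
  move=> /existsPn h; apply/forallP => g; move: (h g).
  by rewrite -ltNge => /ltW.
rewrite lerB //; apply: le_trans hdelta; apply: avg_exists_le => g.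
exact: empirical_deviation.
Qed.

(** * Choice of the parameters *)

(** Since [S1 / gamma <= n], the factor [n] in the grid size can replace [S1 / gamma], which then
    stays out of the logarithm of [M]. *)
Lemma exists_grid_size (R : realType) (m n : nat) (S1 gamma L0 : R) :
  (0 < m)%N -> (0 < n)%N -> 0 < gamma -> S1 / gamma <= n%:R -> 1 <= L0 ->
  m%:R <= expR L0 -> n%:R <= expR L0 ->
  exists M : nat, [/\ (0 < M)%N, S1 * (8 * m%:R / M%:R) <= gamma / 8
    & M%:R <= expR (8 * L0)].
Proof.
move=> m0 n0 g0 Sn L1 mL nL; have n0R : 0 < n%:R :> R by rewrite ltr0n.
exists (64 * m * n)%N; split; first by rewrite !muln_gt0 m0 n0.
  have -> : S1 * (8 * m%:R / (64 * m * n)%:R) = S1 / n%:R / 8.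
    by rewrite !natrM; field; rewrite !pnatr_eq0 -!lt0n m0 n0.
  rewrite ler_pM2r ?invr_gt0 // ler_pdivrMr //.
  by move: Sn; rewrite ler_pdivrMr // mulrC.
(* [6 * L0] pays for [64 = 2^6], and one [L0] each for [m] and [n]. *)
have -> : 8 * L0 = 6 * L0 + L0 + L0 by ring.
rewrite !expRD !natrM; apply: ler_pM; rewrite ?mulr_ge0 //.
apply: ler_pM => //; rewrite expRM_natl (_ : 64 = 2 ^+ 6 :> R); last by ring.
apply: lerXn2r; rewrite ?nnegrE ?expR_ge0 //.
by apply: le_trans (expR_ge1Dx _); lra.
Qed.

(** [4096 = 2 * 2048] makes the tail exponent [N / (2048 a^2)] at least [2 * L0]; rounding up adds
    at most [1 <= 4 a^2 L0], whence 4100. *)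
Lemma exists_sampling_size (R : realType) (a L0 : R) :
  1 / 2 <= a -> 1 <= L0 ->
  exists N : nat, [/\ (0 < N)%N, 4096 * a ^+ 2 * L0 <= N%:R
    & N%:R <= 4100 * a ^+ 2 * L0].
Proof.
move=> a2 L1.
have a4 : 1 <= 4 * a ^+ 2.
  have h : 0 <= (2 * a - 1) * (2 * a + 1) by apply: mulr_ge0; lra.
  by lra.
have aL : 1 * 1 <= 4 * a ^+ 2 * L0 by apply: ler_pM.
have /truncn_itv/andP[le gt] : 0 <= 4096 * a ^+ 2 * L0 by lra.
exists (Num.trunc (4096 * a ^+ 2 * L0)).+1; split; [exact: ltn0Sn | exact: ltW |].
by rewrite -natr1; move: le; clear gt; set t := (Num.trunc _)%:R; lra.
Qed.

(** On the left, the logarithm of the number of grid networks plus that of [1 / delta], both bounded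
    through [L0]; on the right, [n e^2 / 8]. The least integer with square at least [64 * 4100] is
    513. *)
Lemma union_exponent (R : realType) (p N L0 a : R) :
  1 <= L0 -> 0 <= a * p -> N <= 4100 * a ^+ 2 * L0 ->
  8 * L0 * (p * (p * N)) + L0 <= 513 ^+ 2 / 8 * L0 ^+ 2 * (a * p + 1) ^+ 2.
Proof.
move=> L1 ap NU; have L0p : 0 <= L0 by lra.
have h1 : 8 * L0 * (p * (p * N)) <= 8 * L0 * (p * (p * (4100 * a ^+ 2 * L0))).
  by rewrite !(mulrA p) -expr2 !ler_wpM2l ?sqr_ge0 //; lra.
have h2 : L0 <= L0 ^+ 2 by rewrite expr2 ler_peMr.
have h3 : 0 <= L0 ^+ 2 * (a * p) by rewrite mulr_ge0 ?sqr_ge0.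
have h4 : 0 <= L0 ^+ 2 * (a * p) ^+ 2 by rewrite mulr_ge0 ?sqr_ge0.
rewrite exprMn in h4; clear ap NU; lra.
Qed.

(** [L0] is a common bound on the logarithms of [p], [m], [n] and [1 / delta], and carries the whole
    logarithmic factor. *)
Lemma margin_bound (R : realType) (p m d n : nat) (S1 gamma delta L0 : R) :
  (2 <= p)%N -> (1 <= m)%N -> (1 <= n)%N ->
  0 < S1 -> 0 < gamma -> 0 < delta -> 1 <= L0 ->
  p%:R <= expR L0 -> m%:R <= expR L0 -> n%:R <= expR L0 -> delta^-1 <= expR L0 ->
  1 - delta <=
    prob_sample R (fun S : sample p m n =>
      forall (W : 'M[R]_(d, p)) (V : 'M[R]_(p, d)),
        normInf V <= S1 ->
        true_err m W V <=
          emp_margin_err gamma W V S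
          + 600 * L0 * (S1 / gamma * (p%:R / Num.sqrt n%:R))
          + 600 * L0 * (Num.sqrt n%:R)^-1).
Proof.
move=> p2 m1 n1 S0 g0 d0 L1 pL mL nL dL.
have p0 : (0 < p)%N by exact: ltnW.
set rn := Num.sqrt n%:R; set a := S1 / gamma.
have n1R : 1 <= n%:R :> R by rewrite ler1n.
have n0R : 0 < n%:R :> R by rewrite ltr0n.
have p1R : 1 <= p%:R :> R by rewrite ler1n.
have m1R : 1 <= m%:R :> R by rewrite ler1n.
have rnn : rn ^+ 2 = n%:R by rewrite sqr_sqrtr.
have rn0 : 0 < rn by rewrite sqrtr_gt0.
have rn1 : 1 <= rn by have := sqr_ge0 (rn - 1); nra.
have rnle : rn <= n%:R by rewrite -rnn expr2 ler_pMr.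
have a0 : 0 < a by rewrite divr_gt0.
have L0p : 0 < L0 by lra.
have ap0 : 0 < a * p%:R by rewrite mulr_gt0 //; lra.
set E := fun S : sample p m n => _.
have certain : (forall S, E S) -> 1 - delta <= prob_sample R E.
  move=> ES; rewrite /prob_sample (_ : [set S | _] = setT); last first.
    by apply/setP => S; rewrite !inE; apply/asboolP.
  rewrite cardsT divff; first by rewrite lerBlDr lerDl ltW.
  by rewrite pnatr_eq0 -lt0n card_ffun expn_gt0 card_draw_gt0.
have rhs_split : 600 * L0 * (a * (p%:R / rn)) + 600 * L0 * rn^-1 =
    600 * L0 * ((a * p%:R + 1) / rn) by field; rewrite gt_eqF.
have rhs0 : 0 <= 600 * L0 * ((a * p%:R + 1) / rn).
  by rewrite mulr_ge0 ?divr_ge0 ?addr_ge0 ?ltW // mulr_gt0.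
have [gS|gS] := leP gamma (2 * S1); last first.
  apply: certain => S W V VS; rewrite -addrA rhs_split large_margin_err //; last by lra.
  by have := true_err_le1 m W V; lra.
have [big|small] := leP 1 (600 * L0 * ((a * p%:R + 1) / rn)).
  apply: certain => S W V VS; rewrite -addrA rhs_split.
  by have := true_err_le1 m W V; have := emp_margin_err_ge0 gamma W V S; lra.
(* The uniform deviation; the far points will add at most 4 to the constant 513, within 600. *)
pose e := 513 * L0 * ((a * p%:R + 1) / rn).
have a2 : 1 / 2 <= a by rewrite /a ler_pdivlMr //; lra.
have quot0 : 0 < (a * p%:R + 1) / rn by rewrite divr_gt0 // addr_gt0.
have e0 : 0 <= e by rewrite /e; apply: mulr_ge0; [lra | exact: ltW].
have Lquot0 := mulr_gt0 L0p quot0.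
have e2 : e <= 2 by rewrite /e; lra.
(* A bound below 1 forces [a * p + 1 <= rn], hence [S1 / gamma <= n], as the grid size requires. *)
have an : a <= n%:R.
  have ap1 : a * p%:R + 1 <= rn.
    rewrite -[leRHS]mul1r -ler_pdivrMr //.
    have : 0 <= (L0 - 1) * ((a * p%:R + 1) / rn) by apply: mulr_ge0; [lra | exact: ltW].
    by lra.
  have : a <= a * p%:R by rewrite ler_peMr // ltW.
  by lra.
have [M [M0 hM Mexp]] := exists_grid_size m1 n1 g0 an L1 mL nL.
have [N [N0 Nge NU]] := exists_sampling_size a2 L1.
have tail : 4 * p%:R * expR (- (N%:R * (gamma / (8 * S1)) ^+ 2 / 32)) <= 4 / n%:R.
  have pe : p%:R * n%:R <= expR (N%:R * (gamma / (8 * S1)) ^+ 2 / 32) :> R.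
    apply: (@le_trans _ _ (expR (L0 + L0))); first by rewrite expRD ler_pM.
    rewrite ler_expR (_ : _ / 32 = N%:R / (2048 * a ^+ 2)); last first.
      by rewrite /a; field; rewrite !gt_eqF.
    rewrite ler_pdivlMr; last by rewrite mulr_gt0 ?exprn_gt0.
    by move: Nge; clear; lra.
  move: pe; rewrite expRN; set B := expR _; have B0 : 0 < B by exact: expR_gt0.
  by move=> pe; rewrite ler_pdivrMr // [leRHS]mulrAC ler_pdivlMr // -mulrA ler_wpM2l.
have union : #|{: grid_net p M N}|%:R * expR (- (n%:R * e ^+ 2 / 8)) <= delta.
  have cardG : #|{: grid_net p M N}|%:R <= expR (8 * L0 * (p%:R * (p%:R * N%:R))) :> R.
    rewrite card_ffun card_ffun card_prod !card_ord -expnM natrX.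
    rewrite -2!natrM expRM_natr.
    by rewrite lerXn2r ?nnegrE ?expR_ge0.
  have dexp : expR (- L0) <= delta.
    by rewrite expRN invf_ple ?posrE ?expR_gt0.
  apply: le_trans dexp; apply: (le_trans (ler_wpM2r (expR_ge0 _) cardG)).
  rewrite -expRD ler_expR.
  have -> : n%:R * e ^+ 2 / 8 = 513 ^+ 2 / 8 * L0 ^+ 2 * (a * p%:R + 1) ^+ 2.
    by rewrite /e -rnn; field; rewrite gt_eqF.
  by rewrite lerBlDr addrC lerBrDr; apply: union_exponent => //; exact: ltW.
apply: (le_trans (uniform_deviation m S1 gamma p0 e0 e2 union)).
rewrite avgE /prob_sample ler_wpM2r ?invr_ge0 // ler_nat subset_leq_card //.
apply/subsetP => S; rewrite !inE => /forallP unif; apply/asboolP => W V VS.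
have := margin_transfer W p0 M0 N0 S0 g0 gS VS hM unif.
have tail' : 4 / n%:R <= 4 * (L0 * ((a * p%:R + 1) / rn)).
  rewrite ler_pM2l //; apply: (@le_trans _ _ rn^-1); first by rewrite lef_pV2 ?posrE.
  have Lap : 1 * 1 <= L0 * (a * p%:R + 1) by apply: ler_pM; rewrite // lerDr ltW.
  by rewrite mulrA; apply: ler_peMl; [rewrite invr_ge0 ltW | rewrite mul1r in Lap].
move=> h; apply: (le_trans h); rewrite -[leRHS]addrA rhs_split.
rewrite -[leLHS]addrA lerD2l; apply: le_trans (lerD (lexx e) (le_trans tail tail')) _.
by rewrite /e -!(mulrA _ L0); move: Lquot0; set t := L0 * _; clear; lra.
Qed.

(* The O~(.) terms: there are absolute constants C > 0 and k (independent of
   p, m, d, n, S1, gamma, delta) such that each O~(f) is at most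
   C * (ln (e + n + m + p + S1 + 1/delta))^k * f. *)
Theorem mainTheorem9 (R : realType) :
  exists (C : R) (k : nat), 0 < C /\
  forall (p m d n : nat) (S1 gamma delta : R),
    (2 <= p)%N -> (1 <= m)%N -> (1 <= d)%N -> (1 <= n)%N ->
    0 < S1 -> 0 < gamma -> 0 < delta -> delta < 1 ->
    let L := C * (ln (expR 1 + n%:R + m%:R + p%:R + S1 + delta^-1)) ^+ k in
    1 - delta <=
    prob_sample R (fun S : sample p m n =>
      forall (W : 'M[R]_(d, p)) (V : 'M[R]_(p, d)),
        normInf V <= S1 ->
        true_err m W V <=
          emp_margin_err gamma W V S
          + L * (S1 / gamma * (p%:R / Num.sqrt n%:R))
          + L * (Num.sqrt n%:R)^-1).
Proof.
exists 600, 1%N; split=> // p m d n S1 gamma delta p2 m1 _ n1 S0 g0 d0 _ /=.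
rewrite expr1; set A := _ + delta^-1.
have e0 := expR_gt0 (1 : R); have dV : 0 < delta^-1 by rewrite invr_gt0.
have [n0 m0 q0] : [/\ 0 <= n%:R :> R, 0 <= m%:R :> R & 0 <= p%:R :> R] by [].
have A0 : 0 < A by rewrite /A; lra.
(* Take [L0 = ln A]: each of [p], [m], [n], [delta^-1] is at most [A = expR L0], and the summand
   [expR 1] gives [L0 >= 1]. *)
apply: margin_bound => //; rewrite ?lnK ?posrE //; try by rewrite /A; lra.
by rewrite -[leLHS]expRK ler_ln ?posrE //; rewrite /A; lra.
Qed.
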